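(* Let $K$ be a field and let $\mathcal F$ be the $K$-vector space with basis the set of all finite spaces (homeomorphism classes of topologies on finite sets), equipped with the bilinear extensions of the sum (disjoint union) product $.$ and of the join product $\succ$. Then: 1. The commutative algebra $(\mathcal F,.)$ is freely generated by the set of connected spaces. 2. The associative algebra $(\mathcal F,\succ)$ is freely generated by the set of join-indecomposable spaces. 3. The $Com\text{-}As$ algebra $(\mathcal F,.,\succ)$ is freely generated by the set of irreducible spaces.
   Context: A finite space is a homeomorphism class $\overline{\mathcal T}$ of topologies $\mathcal T$ on finite sets; each is represented by a topology on some $[n]=\{1,\dots,n\}$ ($[0]=\emptyset$). The class of the empty space is denoted $1$. For $O\subseteq\mathbb N$ write $O(+n)=\{k+n\mid k\in O\}$. For topologies $\mathcal T$ on $[n]$ and $\mathcal T'$ on $[n']$: - $\mathcal T.\mathcal T'$ is the topology on $[n+n']$ whose open sets are the sets $O\sqcup O'(+n)$ with $O\in\mathcal T$, $O'\in\mathcal T'$; - $\mathcal T\succ\mathcal T'$ is the topology on $[n+n']$ whose open sets are the sets $O\sqcup [n'](+n)$ with $O\in\mathcal T$, and the sets $O'(+n)$ with $O'\in\mathcal T'$. These induce products on finite spaces, $\overline{\mathcal T}.\overline{\mathcal T'}=\overline{\mathcal T.\mathcal T'}$ and $\overline{\mathcal T}\succ\overline{\mathcal T'}=\overline{\mathcal T\succ\mathcal T'}$; both are associative with common unit $1$, and $.$ is commutative. Let $X\neq 1$ be a finite space. $X$ is connected if it cannot be written $X=X'.X''$ with $X',X''\neq 1$ (equivalently, it is connected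 as a topological space). $X$ is join-indecomposable if it cannot be written $X=X'\succ X''$ with $X',X''\neq 1$. $X$ is irreducible if it is both connected and join-indecomposable. A $Com\text{-}As$ algebra is a vector space with two associative products $.$ and $\succ$ sharing the same unit, the first one being also commutative (no further compatibility is required). All algebras are unital and ''freely generated'' refers to the corresponding category (unital commutative associative algebras, unital associative algebras, $Com\text{-}As$ algebras). *)

(* Defs.v *)
From HB Require Import structures.
From mathcomp Require Import all_boot all_order all_algebra generic_quotient.
From mathcomp.multinomials Require Import monalg.

Set Implicit Arguments.
Unset Strict Implicit.
Unset Printing Implicit Defensive.

Import GRing.Theory.

Local Open Scope quotient_scope.

Definition is_topology n (T : {set {set 'I_n}}) :=
  [&& [set: 'I_n] \in T,
      [forall P : {set {set 'I_n}}, (P \subset T) ==> (cover P \in T)]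
    & [forall A in T, forall B in T, A :&: B \in T]].

(* The underlying set [n] is rendered by 'I_n = {0, ..., n - 1}. *)
Record topology n := Topology {
  opens :> {set {set 'I_n}};
  opensP : is_topology opens
}.

HB.instance Definition _ n := [isSub for @opens n].
HB.instance Definition _ n := [Finite of topology n by <:].

Definition ftop := {n : nat & topology n}.

Definition FTop n (T : topology n) : ftop := Tagged topology T.

Definition homeo (X Y : ftop) :=
  [exists f : {ffun 'I_(tag X) -> 'I_(tag Y)},
   exists g : {ffun 'I_(tag Y) -> 'I_(tag X)},
   [&& [forall x, g (f x) == x], [forall y, f (g y) == y],
       [forall U in tagged Y : {set _}, f @^-1: U \in (tagged X : {set _})]
     & [forall V in tagged X : {set _}, g @^-1: V \in (tagged Y : {set _})]]].

Section TopologyTheory.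
Variables (n : nat) (T : topology n).

Lemma topT : [set: 'I_n] \in T.
Proof. by case/and3P: (opensP T). Qed.

Lemma top_cover (P : {set {set 'I_n}}) : P \subset T -> cover P \in T.
Proof. by case/and3P: (opensP T) => _ /forallP/(_ P)/implyP. Qed.

Lemma topI A B : A \in T -> B \in T -> A :&: B \in T.
Proof.
by case/and3P: (opensP T) => _ _ /forall_inP H /H/forall_inP K /K.
Qed.

Lemma top0 : set0 \in T.
Proof.
have <-: cover (set0 : {set {set 'I_n}}) = set0 by rewrite /cover big_set0.
exact/top_cover/sub0set.
Qed.
End TopologyTheory.

Lemma homeoI m n (T : topology m) (T' : topology n) f g :
    cancel f g -> cancel g f ->
    (forall U : {set 'I_n}, (f @^-1: U \in T) = (U \in T')) ->
  homeo (FTop T) (FTop T').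
Proof.
move=> fK gK fT; apply/existsP; exists (finfun f); apply/existsP.
exists (finfun g); apply/and4P; split.
- by apply/forallP => x; rewrite !ffunE fK.
- by apply/forallP => x; rewrite !ffunE gK.
- apply/forall_inP => U /=; rewrite -fT.
  suff ->: finfun f @^-1: U = f @^-1: U by [].
  by apply/setP => x; rewrite !inE ffunE.
- apply/forall_inP => V /= VT; rewrite -fT.
  suff ->: f @^-1: (finfun g @^-1: V) = V by [].
  by apply/setP => x; rewrite !inE ffunE fK.
Qed.

Lemma homeoE (X Y : ftop) : homeo X Y ->
  exists (f : 'I_(tag X) -> 'I_(tag Y)) (g : 'I_(tag Y) -> 'I_(tag X)),
  [/\ cancel f g, cancel g f &
    forall U : {set 'I_(tag Y)}, (f @^-1: U \in (tagged X : {set _})) =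
              (U \in (tagged Y : {set _}))].
Proof.
case/existsP=> f /existsP[g /and4P[/forallP fK /forallP gK]].
move=> /forall_inP fT /forall_inP gT; exists f, g; split.
- by move=> x; apply/eqP.
- by move=> x; apply/eqP.
move=> U; apply/idP/idP => [/gT|/fT//].
suff ->: g @^-1: (f @^-1: U) = U by [].
by apply/setP => x; rewrite !inE (eqP (gK x)).
Qed.

Lemma homeo_refl : reflexive homeo.
Proof.
case=> n T; apply: (@homeoI _ _ T T id id) => // U.
suff ->: id @^-1: U = U by [].
by apply/setP => x; rewrite inE.
Qed.

Lemma homeo_impl_sym X Y : homeo X Y -> homeo Y X.
Proof.
move=> /homeoE[f [g [fK gK fT]]]; case: X Y f g fK gK fT => [m T] [n T'] /=.
move=> f g fK gK fT; apply: (@homeoI _ _ T' T g f) => // U.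
rewrite -fT.
suff ->: f @^-1: (g @^-1: U) = U by [].
by apply/setP => x; rewrite !inE fK.
Qed.

Lemma homeo_sym : symmetric homeo.
Proof. by move=> X Y; apply/idP/idP; apply: homeo_impl_sym. Qed.

Lemma homeo_trans : transitive homeo.
Proof.
move=> Y X Z /homeoE[f [g [fK gK fT]]] /homeoE[f' [g' [fK' gK' fT']]].
case: X Y Z f g f' g' fK gK fT fK' gK' fT' => [m T] [n T'] [p T''] /=.
move=> f g f' g' fK gK fT fK' gK' fT'.
apply: (@homeoI _ _ T T'' (f' \o f) (g \o g')) => [||U].
- exact: can_comp.
- exact: can_comp.
rewrite -fT' -fT.
suff ->: (f' \o f) @^-1: U = f @^-1: (f' @^-1: U) by [].
by apply/setP => x; rewrite !inE.
Qed.

HB.lock Definition homeo_equiv : equiv_rel ftop :=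
  EquivRel homeo homeo_refl homeo_sym homeo_trans.

Definition fspace := {eq_quot homeo_equiv}.

HB.instance Definition _ := Choice.on fspace.
HB.instance Definition _ := EqQuotient.on fspace.

Definition fclass n (T : topology n) : fspace := \pi_fspace (FTop T).

Lemma fclassP m n (T : topology m) (T' : topology n) :
  reflect (fclass T = fclass T') (homeo (FTop T) (FTop T')).
Proof.
apply: (iffP idP) => [h|/eqmodP].
  by apply/eqmodP; rewrite homeo_equiv.unlock.
by rewrite homeo_equiv.unlock.
Qed.

Section Products.
Variables m n : nat.
Implicit Types (A B : {set 'I_(m + n)}) (T : topology m) (S : topology n).

Let lpre A : {set 'I_m} := lshift n @^-1: A.
Let rpre A : {set 'I_n} := @rshift m n @^-1: A.

Definition dot_opens T S : {set {set 'I_(m + n)}} :=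
  [set lshift n @: O :|: @rshift m n @: O' |
    O : {set 'I_m} in T, O' : {set 'I_n} in S].

Definition join_opens T S : {set {set 'I_(m + n)}} :=
  [set lshift n @: O :|: @rshift m n @: [set: 'I_n] |
    O : {set 'I_m} in T] :|:
  [set @rshift m n @: O' | O' : {set 'I_n} in S].

Lemma sum_setE A : lshift n @: lpre A :|: @rshift m n @: rpre A = A.
Proof.
apply/setP => i; rewrite inE; apply/idP/idP.
  by case/orP=> /imsetP[j]; rewrite inE => jA ->.
rewrite -(splitK i); case: (split i) => j /= jA.
  by rewrite imset_f ?inE.
by rewrite [X in _ || X]imset_f ?orbT ?inE.
Qed.

Lemma sum_setP A B : lpre A = lpre B -> rpre A = rpre B -> A = B.
Proof. by move=> eql eqr; rewrite -(sum_setE A) eql eqr sum_setE. Qed.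

Lemma lpreU (O : {set 'I_m}) (O' : {set 'I_n}) :
  lpre (lshift n @: O :|: @rshift m n @: O') = O.
Proof.
apply/setP => i; rewrite !inE mem_imset; last exact: lshift_inj.
case: imsetP => [[j _ /eqP]|_]; last by rewrite orbF.
by rewrite eq_lrshift.
Qed.

Lemma rpreU (O : {set 'I_m}) (O' : {set 'I_n}) :
  rpre (lshift n @: O :|: @rshift m n @: O') = O'.
Proof.
apply/setP => i; rewrite !inE [X in _ || X]mem_imset; last exact: rshift_inj.
by case: imsetP => [[j _ /eqP]|_] //; rewrite eq_rlshift.
Qed.

Lemma mem_dot_opens T S A :
  (A \in dot_opens T S) = (lpre A \in T) && (rpre A \in S).
Proof.
apply/imset2P/andP => [[O O' OT OS ->]|[lA rA]].
  by rewrite lpreU rpreU.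
by exists (lpre A) (rpre A) => //; rewrite sum_setE.
Qed.

Lemma mem_join_opens T S A : (A \in join_opens T S) =
  (lpre A \in T) && (rpre A == setT) || (lpre A == set0) && (rpre A \in S).
Proof.
rewrite inE; congr (_ || _).
  apply/imsetP/andP => [[O OT ->]|[lA /eqP rA]].
    by rewrite lpreU rpreU.
  by exists (lpre A) => //; rewrite -rA sum_setE.
apply/imsetP/andP => [[O' OS ->]|[/eqP lA rA]].
  by rewrite -[imset _ _]set0U -(imset0 (lshift n)) lpreU rpreU.
by exists (rpre A) => //; rewrite -[LHS]sum_setE lA imset0 set0U.
Qed.

Lemma lpre_cover (P : {set {set 'I_(m + n)}}) :
  lpre (cover P) = cover [set lpre A | A in P].
Proof.
apply/setP => i; rewrite inE; apply/bigcupP/bigcupP => [[A AP iA]|[X]].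
  by exists (lpre A); rewrite ?inE ?imset_f.
by case/imsetP=> A AP ->{X}; rewrite inE => iA; exists A.
Qed.

Lemma rpre_cover (P : {set {set 'I_(m + n)}}) :
  rpre (cover P) = cover [set rpre A | A in P].
Proof.
apply/setP => i; rewrite inE; apply/bigcupP/bigcupP => [[A AP iA]|[X]].
  by exists (rpre A); rewrite ?inE ?imset_f.
by case/imsetP=> A AP ->{X}; rewrite inE => iA; exists A.
Qed.

Lemma dot_topology T S : is_topology (dot_opens T S).
Proof.
apply/and3P; split; first by rewrite mem_dot_opens /lpre /rpre !preimsetT !topT.
  apply/forallP => P; apply/implyP => /subsetP PT.
  rewrite mem_dot_opens lpre_cover rpre_cover.
  by apply/andP; split; apply: top_cover; apply/subsetP => _ /imsetP[A AP ->];
    have := PT A AP; rewrite mem_dot_opens => /andP[].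
apply/forall_inP => A; rewrite (mem_dot_opens _ _ A) => /andP[lA rA].
apply/forall_inP => B; rewrite (mem_dot_opens _ _ B) => /andP[lB rB].
by rewrite mem_dot_opens /lpre /rpre !preimsetI !topI.
Qed.

Lemma join_topology T S : is_topology (join_opens T S).
Proof.
apply/and3P; split.
- by rewrite mem_join_opens /lpre /rpre !preimsetT topT eqxx.
- apply/forallP => P; apply/implyP => /subsetP PT.
  rewrite mem_join_opens lpre_cover rpre_cover.
  have PE A : A \in P -> (lpre A \in T) && (rpre A == setT) ||
      (lpre A == set0) && (rpre A \in S) by move=> /PT; rewrite mem_join_opens.
  have [/existsP[A /andP[AP /eqP rA]]|] :=
    boolP [exists A, (A \in P) && (rpre A == setT)].
    apply/orP; left; apply/andP; split.
      apply: top_cover; apply/subsetP => _ /imsetP[B BP ->].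
      by case/orP: (PE B BP)=> /andP[] // /eqP-> _; rewrite top0.
    rewrite eqEsubset subsetT -rA /cover (bigcup_max (rpre A)) //.
    exact: imset_f.
  rewrite negb_exists => /forallP nP; apply/orP; right; apply/andP; split.
    rewrite -subset0; apply/bigcupsP => _ /imsetP[A AP ->].
    have := nP A; rewrite AP /= => rA; have := PE A AP.
    by rewrite (negbTE rA) andbF /= => /andP[/eqP->].
  apply: top_cover; apply/subsetP => _ /imsetP[A AP ->].
  by case/orP: (PE A AP)=> /andP[_] // /eqP->; rewrite topT.
apply/forall_inP => A; rewrite (mem_join_opens _ _ A) => hA.
apply/forall_inP => B; rewrite (mem_join_opens _ _ B) => hB.
rewrite mem_join_opens /lpre /rpre !preimsetI -!/(lpre _) -!/(rpre _).
case/orP: hA => /andP[lA rA]; case/orP: hB => /andP[lB rB].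
- by rewrite topI // (eqP rA) (eqP rB) setTI eqxx.
- by rewrite (eqP rA) (eqP lB) setI0 setTI eqxx rB orbT.
- by rewrite (eqP lA) (eqP rB) set0I setIT eqxx rA orbT.
- by rewrite (eqP lA) set0I eqxx topI ?orbT.
Qed.

Definition top_dot T S : topology (m + n) := Topology (dot_topology T S).
Definition top_join T S : topology (m + n) := Topology (join_topology T S).

End Products.

Definition fdot (X Y : fspace) : fspace :=
  fclass (top_dot (tagged (repr X)) (tagged (repr Y))).

Definition fjoin (X Y : fspace) : fspace :=
  fclass (top_join (tagged (repr X)) (tagged (repr Y))).

Lemma empty_topology : is_topology [set: {set 'I_0}].
Proof.
by apply/and3P; split; [|apply/forallP => P|apply/forall_inP => A _;
  apply/forall_inP => B _]; rewrite inE ?implybT.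
Qed.

Definition fone : fspace := fclass (Topology empty_topology).

Lemma fclass_repr (X : fspace) : fclass (tagged (repr X)) = X.
Proof. by rewrite /fclass /FTop; case: (repr X) (reprK X). Qed.

Lemma fspaceW (P : fspace -> Prop) :
  (forall n (T : topology n), P (fclass T)) -> forall X, P X.
Proof. by move=> PT X; rewrite -(fclass_repr X). Qed.

Section SumMap.
Variables (m n p q : nat) (f : 'I_m -> 'I_p) (g : 'I_n -> 'I_q).

Definition sum_map (i : 'I_(m + n)) : 'I_(p + q) :=
  match split i with inl j => lshift q (f j) | inr k => rshift p (g k) end.

Lemma sum_map_l j : sum_map (lshift n j) = lshift q (f j).
Proof. by rewrite /sum_map (unsplitK (inl j)). Qed.

Lemma sum_map_r k : sum_map (rshift m k) = rshift p (g k).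
Proof. by rewrite /sum_map (unsplitK (inr k)). Qed.
End SumMap.

Lemma sum_mapK m n p q (f : 'I_m -> 'I_p) (g : 'I_n -> 'I_q) f' g' :
  cancel f f' -> cancel g g' -> cancel (sum_map f g) (sum_map f' g').
Proof.
move=> fK gK i; rewrite -(splitK i); case: (split i) => j /=.
  by rewrite !sum_map_l fK.
by rewrite !sum_map_r gK.
Qed.

Lemma preim_lsum m n p q (f : 'I_m -> 'I_p) (g : 'I_n -> 'I_q)
    (U : {set 'I_(p + q)}) :
  @lshift m n @^-1: (sum_map f g @^-1: U) = f @^-1: (@lshift p q @^-1: U).
Proof. by apply/setP => i; rewrite !inE sum_map_l. Qed.

Lemma preim_rsum m n p q (f : 'I_m -> 'I_p) (g : 'I_n -> 'I_q)
    (U : {set 'I_(p + q)}) :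
  @rshift m n @^-1: (sum_map f g @^-1: U) = g @^-1: (@rshift p q @^-1: U).
Proof. by apply/setP => i; rewrite !inE sum_map_r. Qed.

Lemma preim_eq0 (aT bT : finType) (f : aT -> bT) g (U : {set bT}) :
  cancel g f -> (f @^-1: U == set0) = (U == set0).
Proof.
move=> gK; apply/eqP/eqP => [/setP fU|->]; last exact: preimset0.
by apply/setP => x; have := fU (g x); rewrite !inE gK.
Qed.

Lemma preim_eqT (aT bT : finType) (f : aT -> bT) g (U : {set bT}) :
  cancel g f -> (f @^-1: U == setT) = (U == setT).
Proof.
move=> gK; apply/eqP/eqP => [/setP fU|->]; last exact: preimsetT.
by apply/setP => x; have := fU (g x); rewrite !inE gK.
Qed.

Lemma homeo_fclass m (T : topology m) :
  exists f g, [/\ cancel f g, cancel g f & forall U : {set 'I_m},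
    (f @^-1: U \in tagged (repr (fclass T))) = (U \in T)].
Proof.
apply: (@homeoE (repr (fclass T)) (FTop T)).
have := fclass_repr (fclass T); case: (repr _) => n S /=.
by move/fclassP.
Qed.

Lemma fdotE m n (T : topology m) (S : topology n) :
  fdot (fclass T) (fclass S) = fclass (top_dot T S).
Proof.
have [f [f' [fK fK' fT]]] := homeo_fclass T.
have [g [g' [gK gK' gT]]] := homeo_fclass S.
apply/fclassP; apply: (homeoI (sum_mapK fK gK) (sum_mapK fK' gK')) => U.
by rewrite !mem_dot_opens preim_lsum preim_rsum fT gT.
Qed.

Lemma fjoinE m n (T : topology m) (S : topology n) :
  fjoin (fclass T) (fclass S) = fclass (top_join T S).
Proof.
have [f [f' [fK fK' fT]]] := homeo_fclass T.
have [g [g' [gK gK' gT]]] := homeo_fclass S.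
apply/fclassP; apply: (homeoI (sum_mapK fK gK) (sum_mapK fK' gK')) => U.
by rewrite !mem_join_opens preim_lsum preim_rsum fT gT (preim_eq0 _ fK')
  (preim_eqT _ gK').
Qed.

Lemma preim_castl m n p (U : {set 'I_(m + n + p)}) :
  @lshift m (n + p) @^-1: (cast_ord (addnA m n p) @^-1: U) =
  @lshift m n @^-1: (@lshift (m + n) p @^-1: U).
Proof.
apply/setP => i; rewrite !inE; congr (_ \in U); exact: val_inj.
Qed.

Lemma preim_castm m n p (U : {set 'I_(m + n + p)}) :
  @lshift n p @^-1: (@rshift m (n + p) @^-1:
    (cast_ord (addnA m n p) @^-1: U)) =
  @rshift m n @^-1: (@lshift (m + n) p @^-1: U).
Proof.
apply/setP => i; rewrite !inE; congr (_ \in U); exact: val_inj.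
Qed.

Lemma preim_castr m n p (U : {set 'I_(m + n + p)}) :
  @rshift n p @^-1: (@rshift m (n + p) @^-1:
    (cast_ord (addnA m n p) @^-1: U)) = @rshift (m + n) p @^-1: U.
Proof.
apply/setP => i; rewrite !inE; congr (_ \in U); apply: val_inj => /=.
exact: addnA.
Qed.

Lemma sum_set_eqT m n (U : {set 'I_(m + n)}) : (U == setT) =
  (@lshift m n @^-1: U == setT) && (@rshift m n @^-1: U == setT).
Proof.
apply/eqP/andP => [->|[/eqP lU /eqP rU]]; first by rewrite !preimsetT !eqxx.
by apply: sum_setP; rewrite ?lU ?rU preimsetT.
Qed.

Lemma sum_set_eq0 m n (U : {set 'I_(m + n)}) : (U == set0) =
  (@lshift m n @^-1: U == set0) && (@rshift m n @^-1: U == set0).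
Proof.
apply/eqP/andP => [->|[/eqP lU /eqP rU]]; first by rewrite !preimset0 !eqxx.
by apply: sum_setP; rewrite ?lU ?rU preimset0.
Qed.

Lemma fdotA : associative fdot.
Proof.
elim/fspaceW => m T; elim/fspaceW => n S; elim/fspaceW => p R.
rewrite !fdotE; apply/fclassP.
apply: (homeoI (cast_ordK (addnA m n p)) (cast_ordKV _)) => U.
by rewrite !mem_dot_opens preim_castl preim_castm preim_castr andbA.
Qed.

Lemma fjoinA : associative fjoin.
Proof.
elim/fspaceW => m T; elim/fspaceW => n S; elim/fspaceW => p R.
rewrite !fjoinE; apply/fclassP.
apply: (homeoI (cast_ordK (addnA m n p)) (cast_ordKV _)) => U.
rewrite !mem_join_opens (sum_set_eqT (@rshift m (n + p) @^-1: _)).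
rewrite (sum_set_eq0 (lshift p @^-1: _)).
rewrite preim_castl preim_castm preim_castr.
set A := _ @^-1: (_ @^-1: U); set B := _ @^-1: (_ @^-1: U); set C := _ @^-1: U.
case: (A =P set0) => [->|_] /=; last by rewrite !orbF -andbA.
rewrite top0.
have -> : (C \in R) = (C == setT) || (C \in R) by case: eqP => [->|]; rewrite ?topT.
case: (B =P set0) => [->|]; rewrite ?top0; case: (C =P setT) => [->|] //=;
  rewrite ?topT ?andbT ?andbF ?orbF ?orbT //.
Qed.

Lemma fdotC : commutative fdot.
Proof.
elim/fspaceW => m T; elim/fspaceW => n S; rewrite !fdotE; apply/fclassP.
pose sw a b (i : 'I_(a + b)) : 'I_(b + a) :=
  match split i with inl j => rshift b j | inr k => lshift a k end.
have swl a b j : sw a b (lshift b j) = rshift b j.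
  by rewrite /sw (unsplitK (inl j)).
have swr a b k : sw a b (rshift a k) = lshift a k.
  by rewrite /sw (unsplitK (inr k)).
have swK a b : cancel (sw a b) (sw b a).
  move=> i; rewrite -(splitK i).
  by case: (split i) => j /=; rewrite ?(swl, swr).
apply: (homeoI (swK m n) (swK n m)) => U; rewrite !mem_dot_opens andbC.
suff [-> ->] : @rshift m n @^-1: (sw m n @^-1: U) = @lshift n m @^-1: U /\
  @lshift m n @^-1: (sw m n @^-1: U) = @rshift n m @^-1: U by [].
by split; apply/setP => i; rewrite !inE ?(swl, swr).
Qed.

Lemma set_ord0 (U V : {set 'I_0}) : U = V.
Proof. by apply/setP => -[]. Qed.

Lemma rshift0K n : cancel (@rshift 0 n) id.
Proof. by move=> i; apply: val_inj. Qed.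

Lemma id_rshift0 n : cancel id (@rshift 0 n).
Proof. by move=> i; apply: val_inj. Qed.

Lemma lshift0K n : cancel (@lshift n 0) (cast_ord (addn0 n)).
Proof. by move=> i; apply: val_inj. Qed.

Lemma cast_lshift0 n : cancel (cast_ord (addn0 n)) (@lshift n 0).
Proof. by move=> i; apply: val_inj. Qed.

Lemma fdot1x : left_id fone fdot.
Proof.
elim/fspaceW => n T; rewrite fdotE; apply/esym/fclassP.
by apply: (homeoI (@rshift0K n) (@id_rshift0 n)) => U; rewrite mem_dot_opens !inE.
Qed.

Lemma fdotx1 : right_id fone fdot.
Proof. by move=> X; rewrite fdotC fdot1x. Qed.

Lemma fjoin1x : left_id fone fjoin.
Proof.
elim/fspaceW => n T; rewrite fjoinE; apply/esym/fclassP.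
apply: (homeoI (@rshift0K n) (@id_rshift0 n)) => U; rewrite mem_join_opens !inE.
rewrite (set_ord0 (lshift n @^-1: U) set0) eqxx /=.
by case: eqP => [->|]; rewrite ?topT.
Qed.

Lemma fjoinx1 : right_id fone fjoin.
Proof.
elim/fspaceW => n T; rewrite fjoinE; apply/esym/fclassP.
apply: (homeoI (@lshift0K n) (@cast_lshift0 n)) => U; rewrite mem_join_opens.
rewrite (set_ord0 (@rshift n 0 @^-1: U) setT) eqxx andbT inE andbT.
by case: eqP => [->|]; rewrite ?top0 ?orbF.
Qed.

Lemma fclass_eq1 n (T : topology n) : fclass T = fone <-> n = 0.
Proof.
split=> [/fclassP/homeoE[/= f [g [_ gK _]]]|]; last first.
  move=> n0; move: T; rewrite n0 => T; apply/fclassP.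
  apply: (@homeoI _ _ _ _ id id) => // U.
  by rewrite (set_ord0 (id @^-1: U) setT) topT inE.
by case: n T f g gK => // n T f g _; case: (f ord0).
Qed.

Lemma fdot_eq1 X Y : fdot X Y = fone -> X = fone /\ Y = fone.
Proof.
elim/fspaceW: X => m T; elim/fspaceW: Y => n S.
rewrite fdotE !fclass_eq1 => /eqP.
by rewrite addn_eq0 => /andP[/eqP-> /eqP->].
Qed.

Lemma fjoin_eq1 X Y : fjoin X Y = fone -> X = fone /\ Y = fone.
Proof.
elim/fspaceW: X => m T; elim/fspaceW: Y => n S.
rewrite fjoinE !fclass_eq1 => /eqP.
by rewrite addn_eq0 => /andP[/eqP-> /eqP->].
Qed.

Definition connected (X : fspace) :=
  X != fone /\ ~ exists Y Z, [/\ Y != fone, Z != fone & X = fdot Y Z].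

Definition join_indecomposable (X : fspace) :=
  X != fone /\ ~ exists Y Z, [/\ Y != fone, Z != fone & X = fjoin Y Z].

Definition irreducible (X : fspace) := connected X /\ join_indecomposable X.

Definition fspace_dot := fspace.
HB.instance Definition _ := Choice.on fspace_dot.
HB.instance Definition _ :=
  Choice_isMonomialDef.Build fspace_dot fdotA fdot1x fdotx1 fdot_eq1.
HB.instance Definition _ := MonomialDef_isConomialDef.Build fspace_dot fdotC.

Definition fspace_join := fspace.
HB.instance Definition _ := Choice.on fspace_join.
HB.instance Definition _ :=
  Choice_isMonomialDef.Build fspace_join fjoinA fjoin1x fjoinx1 fjoin_eq1.

Local Open Scope ring_scope.

(* The commutative product is that of the underlying algebra; the second      *)
(* product shares its unit 1.                                                 *)
HB.mixin Record ComAlgebra_isComAs (K : fieldType) A of GRing.ComAlgebra K A := {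
  join_mul : A -> A -> A;
  join_mulA : associative join_mul;
  join_mul1x : left_id 1 join_mul;
  join_mulx1 : right_id 1 join_mul;
  join_mul_linearl : forall y, linear (join_mul^~ y);
  join_mul_linearr : forall x, linear (join_mul x)
}.

#[short(type="comAsType")]
HB.structure Definition ComAs (K : fieldType) :=
  {A of GRing.ComAlgebra K A & ComAlgebra_isComAs K A}.

Section FreeGeneration.
Variable K : fieldType.

(* In the three definitions below f stands for a map from the subset S to B:  *)
(* its values outside S play no role. Library algebras satisfy 1 != 0, which  *)
(* only discards the target B = 0, where all maps agree.                      *)
Definition com_alg_freely_generated (A : comAlgType K) (S : A -> Prop) :=
  forall (B : comAlgType K) (f : A -> B),
  exists phi : {lrmorphism A -> B},
    (forall x, S x -> phi x = f x) /\
    (forall psi : {lrmorphism A -> B},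
       (forall x, S x -> psi x = f x) -> psi =1 phi).

Definition alg_freely_generated (A : algType K) (S : A -> Prop) :=
  forall (B : algType K) (f : A -> B),
  exists phi : {lrmorphism A -> B},
    (forall x, S x -> phi x = f x) /\
    (forall psi : {lrmorphism A -> B},
       (forall x, S x -> psi x = f x) -> psi =1 phi).

Definition com_as_freely_generated (A : comAsType K) (S : A -> Prop) :=
  forall (B : comAsType K) (f : A -> B),
  exists phi : {lrmorphism A -> B},
    [/\ {morph phi : x y / join_mul x y},
        forall x, S x -> phi x = f x
      & forall psi : {lrmorphism A -> B},
          {morph psi : x y / join_mul x y} ->
          (forall x, S x -> psi x = f x) -> psi =1 phi].

End FreeGeneration.

Lemma malg_scalerAr (M : monomType) (R : comNzRingType) (c : R)
  (x y : {malg R[M]}) : c *: (x * y) = x * (c *: y).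
Proof.
rewrite (malgMEw (d1 := msupp x) (d2 := msupp y)) //.
rewrite [RHS](malgMEw (d1 := msupp x) (d2 := msupp y)) ?msuppZ_le //.
rewrite scaler_sumr; apply: eq_bigr => k _.
rewrite scaler_sumr; apply: eq_bigr => l _; apply/malgP => j.
by rewrite !(mcoeffZ, mcoeffU) mulrnAr mulrCA.
Qed.

Section FiniteSpaceAlgebra.
Variable K : fieldType.

(* The vector space with basis fspace, with each of its two products as ring  *)
(* multiplication. The product of {malg K[M]} is the bilinear extension of    *)
(* the product of the monoid M, and << X >> is the basis vector X.            *)
Definition FS_dot := {malg K[fspace_dot]}.
HB.instance Definition _ := GRing.ComAlgebra.on FS_dot.

Definition FS_join := {malg K[fspace_join]}.
HB.instance Definition _ := GRing.Lalgebra.on FS_join.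

HB.instance Definition _ :=
  GRing.Lalgebra_isAlgebra.Build K FS_join
  (@malg_scalerAr fspace_join K).

Definition FS_join_mul (x y : FS_dot) : FS_dot := (x : FS_join) * (y : FS_join).

Lemma FS_join_mulA : associative FS_join_mul.
Proof. by move=> x y z; exact: (@mulrA FS_join). Qed.

Lemma FS_join_mul1x : left_id 1 FS_join_mul.
Proof. by move=> x; exact: (@mul1r FS_join). Qed.

Lemma FS_join_mulx1 : right_id 1 FS_join_mul.
Proof. by move=> x; exact: (@mulr1 FS_join). Qed.

Lemma FS_join_mul_linearl y : linear (FS_join_mul^~ y).
Proof.
move=> c u v; rewrite /FS_join_mul.
rewrite [LHS](@mulrDl FS_join (c *: (u : FS_join)) v y).
by rewrite -(@scalerAl K FS_join).
Qed.

Lemma FS_join_mul_linearr x : linear (FS_join_mul x).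
Proof.
move=> c u v; rewrite /FS_join_mul.
rewrite [LHS](@mulrDr FS_join x (c *: (u : FS_join)) v).
by rewrite -(@scalerAr K FS_join).
Qed.

HB.instance Definition _ := ComAlgebra_isComAs.Build K FS_dot
  FS_join_mulA FS_join_mul1x FS_join_mulx1
  FS_join_mul_linearl FS_join_mul_linearr.

Lemma FS_dotU (X Y : fspace) :
  (<< X >> : FS_dot) * << Y >> = << fdot X Y >> :> FS_dot.
Proof. by rewrite [LHS]fgmulUU mulr1. Qed.

Lemma FS_joinU (X Y : fspace) :
  join_mul (<< X >> : FS_dot) << Y >> = << fjoin X Y >>.
Proof. by rewrite [LHS](@fgmulUU fspace_join) mulr1. Qed.

Definition basis_vectors (P : fspace -> Prop) (x : {malg K[fspace]}) :=
  exists2 X, P X & x = << X >>.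

End FiniteSpaceAlgebra.

(* Main.v *)
Require Import Defs.
From HB Require Import structures.
From mathcomp Require Import all_boot all_order all_algebra.
From mathcomp.multinomials Require Import monalg.
From Stdlib Require Import ClassicalEpsilon.

(* Sum decompositions of a space T correspond to its clopen subsets, and join *)
(* decompositions to the open sets V comparable with every open set.          *)
(* Intersecting two clopen sets refines two sum decompositions into a common  *)
(* one; two sets V are comparable with each other, whence Levi's lemma for    *)
(* the join; and a proper clopen subset excludes a proper V. So a space       *)
(* decomposes for at most one product, and any two of its decompositions have *)
(* a common refinement. By recursion on the number of points, a map on        *)
(* indecomposable spaces then extends uniquely to all finite spaces           *)
(* compatibly with the products, and linearly to the algebra.                 *)

Set Implicit Arguments.
Unset Strict Implicit.
Unset Printing Implicit Defensive.

Import GRing.Theory.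

(** The finite spaces form a basis, so a morphism of algebras is determined by its values on spaces.
    Each freeness claim thus reduces to one about spaces alone: every map on the indecomposable ones
    extends in exactly one way to all spaces compatibly with the unit and the products.

    Uniqueness holds because a space can be split until its factors are indecomposable, the number
    of points dropping each time ([operation_morphism_ext]). Existence requires that two
    decompositions of one space give the same value ([operation_morphism_exists]). By [fdotP] and
    [fjoinP] a decomposition is a subset of the points. Two clopen sets cut the space into four
    corners, and commutativity reconciles the two ways of grouping them ([fdot_refinement]). Two
    open sets comparable with every open set are nested, and associativity reconciles the two
    bracketings of the three layers ([fjoin_levi]). A sum and a join with nontrivial factors never
    coincide ([fdot_neq_fjoin]), so with both products present no further relation arises. *)

Lemma topU n (T : topology n) (A B : {set 'I_n}) :
  A \in T -> B \in T -> A :|: B \in T.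
Proof.
move=> AT BT; have <- : cover [set A; B] = A :|: B.
  by rewrite /cover bigcup_setU !big_set1.
by apply: top_cover; apply/subsetP => O /set2P[]->.
Qed.

(** * Induced topologies and subspaces up to homeomorphism *)

Section InitialTopology.
Variables (m n : nat) (h : 'I_m -> 'I_n) (T : topology n).

Definition initial_opens : {set {set 'I_m}} :=
  [set h @^-1: U | U : {set 'I_n} in T].

Lemma initial_topology : is_topology initial_opens.
Proof.
apply/and3P; split.
- by apply/imsetP; exists setT; rewrite ?topT ?preimsetT.
- apply/forallP => P; apply/implyP => /subsetP PT; apply/imsetP.
  (* Taking every open set whose preimage lies in [P] avoids choosing one for each member of [P]. *)
  exists (cover [set U in T | h @^-1: U \in P]).
    by apply: top_cover; apply/subsetP => U; rewrite inE => /andP[].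
  apply/setP => x; rewrite inE; apply/bigcupP/bigcupP => [[A AP]|[U]].
    have /imsetP[U UT defA] := PT A AP; rewrite defA inE => hxU.
    by exists U; rewrite // inE UT -defA.
  by rewrite inE => /andP[UT UP] xU; exists (h @^-1: U); rewrite // inE.
apply/forall_inP => _ /imsetP[U UT ->]; apply/forall_inP => _ /imsetP[V VT ->].
by rewrite -preimsetI imset_f // topI.
Qed.

Definition initial : topology m := Topology initial_topology.

End InitialTopology.

Definition embedding m n (R : topology m) (T : topology n) (h : 'I_m -> 'I_n) :=
  injective h /\ R = initial h T.

Lemma topology_eq n (T S : topology n) :
  (forall U : {set 'I_n}, (U \in T) = (U \in S)) -> T = S.
Proof. by move=> eqTS; apply/val_inj/setP. Qed.

Lemma preim_comp (aT bT cT : finType) (f : aT -> bT) (g : bT -> cT)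
    (U : {set cT}) :
  (g \o f) @^-1: U = f @^-1: (g @^-1: U).
Proof. by apply/setP => x; rewrite !inE. Qed.

Lemma embedding_comp m n p (R : topology m) (S : topology n) (T : topology p)
    f g :
  embedding R S f -> embedding S T g -> embedding R T (g \o f).
Proof.
move=> [f_inj ->] [g_inj ->]; split; first exact: inj_comp.
apply: topology_eq => U; apply/imsetP/imsetP => [[_ /imsetP[W WT ->] ->]|].
  by exists W; rewrite // (preim_comp f g).
by move=> [W WT ->]; exists (g @^-1: W); rewrite ?(preim_comp f g) ?imset_f.
Qed.

Lemma embedding_homeo m n (T : topology m) (S : topology n) f g :
    cancel f g -> cancel g f ->
    (forall U : {set 'I_n}, (f @^-1: U \in T) = (U \in S)) ->
  embedding S T g.
Proof.
move=> fK gK fT; split; first exact: can_inj gK.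
apply: topology_eq => U; apply/idP/imsetP => [US|[W WT ->]].
  exists (f @^-1: U); rewrite ?fT //.
  by apply/setP => x; rewrite !inE gK.
rewrite -fT; suff -> : f @^-1: (g @^-1: W) = W by [].
by apply/setP => x; rewrite !inE fK.
Qed.

(** Sending a point of one source to the point of the other with the same image is a bijection, and
    both topologies are pulled back from [T]. Hence a subspace depends only on its set of points. *)
Lemma eq_embedding m m' n (R : topology m) (R' : topology m') (T : topology n)
    h h' :
    embedding R T h -> embedding R' T h' -> h @: setT = h' @: setT ->
  fclass R = fclass R'.
Proof.
move=> [h_inj ->] [h'_inj ->] eq_im.
have lift a b (k : 'I_a -> 'I_n) (l : 'I_b -> 'I_n) :
    k @: setT = l @: setT -> exists f : 'I_a -> 'I_b, forall x, l (f x) = k x.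
  move=> eq_kl; apply: (fin_all_exists (P := fun x y => l y = k x)) => x.
  have : k x \in l @: setT by rewrite -eq_kl imset_f.
  by case/imsetP => y _ ->; exists y.
have [f fP] := lift _ _ _ _ eq_im; have [g gP] := lift _ _ _ _ (esym eq_im).
have fK : cancel f g by move=> x; apply: h_inj; rewrite gP fP.
have gK : cancel g f by move=> x; apply: h'_inj; rewrite fP gP.
apply/fclassP; apply: (homeoI fK gK) => U.
apply/imsetP/imsetP => -[W WT].
  move=> /setP eqU; exists W => //; apply/setP => x.
  by have := eqU (g x); rewrite !inE gK gP.
by move=> ->; exists W => //; apply/setP => x; rewrite !inE fP.
Qed.

(** Spaces live on initial segments, so the points of [S] are renumbered by [enum_val]. Only the
    class is kept, and by [fsubE] any other numbering gives the same one. *)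
Definition fsub n (T : topology n) (S : {set 'I_n}) : fspace :=
  fclass (initial (@enum_val _ (mem S)) T).

Lemma imset_enum_val n (S : {set 'I_n}) : @enum_val _ (mem S) @: setT = S.
Proof.
apply/setP => x; apply/imsetP/idP => [[i _ ->]|xS]; first exact: enum_valP.
by exists (enum_rank_in xS x); rewrite // enum_rankK_in.
Qed.

Lemma fsubE m n (R : topology m) (T : topology n) h :
  embedding R T h -> fsub T (h @: setT) = fclass R.
Proof.
move=> hP; apply: eq_embedding hP _; last exact: imset_enum_val.
by split; first exact: enum_val_inj.
Qed.

Lemma fsubT n (T : topology n) : fsub T setT = fclass T.
Proof.
have idU (V : {set 'I_n}) : id @^-1: V = V by apply/setP => x; rewrite inE.
rewrite -[setT]imset_id; apply: (@fsubE _ _ _ _ id); split=> //.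
apply: topology_eq => U; apply/idP/imsetP => [UT|[V VT ->]].
  by exists U; rewrite ?idU.
by rewrite idU.
Qed.

Lemma fsub_eq1 n (T : topology n) S : fsub T S = fone <-> S = set0.
Proof.
rewrite fclass_eq1; split=> [/eqP|->]; last exact: cards0.
by rewrite cards_eq0 => /eqP.
Qed.

(** * Cutting subspaces along clopen sets and along comparable open sets *)

Section SubspaceSum.
Variables (n : nat) (T : topology n) (S1 S2 : {set 'I_n}).
Let e1 := @enum_val _ (mem S1).
Let e2 := @enum_val _ (mem S2).

(** Listing [S1] before [S2] makes the source literally the carrier of [top_dot] and [top_join],
    unlike the increasing enumeration of the union. *)
Definition sum_enum (i : 'I_(#|S1| + #|S2|)) : 'I_n :=
  match split i with inl j => e1 j | inr k => e2 k end.

Lemma preim_sum_enuml (U : {set 'I_n}) :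
  @lshift #|S1| #|S2| @^-1: (sum_enum @^-1: U) = e1 @^-1: U.
Proof. by apply/setP => i; rewrite !inE /sum_enum (unsplitK (inl i)). Qed.

Lemma preim_sum_enumr (U : {set 'I_n}) :
  @rshift #|S1| #|S2| @^-1: (sum_enum @^-1: U) = e2 @^-1: U.
Proof. by apply/setP => i; rewrite !inE /sum_enum (unsplitK (inr i)). Qed.

Lemma sum_enum_inj : [disjoint S1 & S2] -> injective sum_enum.
Proof.
move=> dis12 i j; rewrite -(splitK i) -(splitK j).
have dis (x : 'I_#|S1|) (y : 'I_#|S2|) : e1 x <> e2 y.
  move=> eq12; have := disjointFr dis12 (enum_valP x).
  by rewrite -/(e1 x) eq12 enum_valP.
case: (split i) => x; case: (split j) => y; rewrite /sum_enum !unsplitK.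
- by move/enum_val_inj->.
- by move/dis.
- by move/esym/dis.
- by move/enum_val_inj->.
Qed.

Lemma imset_sum_enum : sum_enum @: setT = S1 :|: S2.
Proof.
apply/setP => x; rewrite inE; apply/imsetP/orP => [[i _ ->]|].
  by rewrite /sum_enum; case: (split i) => j; [left|right]; apply: enum_valP.
by case=> xS; [exists (unsplit (inl (enum_rank_in xS x)))
  |exists (unsplit (inr (enum_rank_in xS x)))];
  rewrite // /sum_enum unsplitK /= ?/e1 ?/e2 enum_rankK_in.
Qed.
End SubspaceSum.

Lemma eq_preim_enum_val n (S U V : {set 'I_n}) : U :&: S = V :&: S ->
  @enum_val _ (mem S) @^-1: U = @enum_val _ (mem S) @^-1: V.
Proof.
move=> /setP eqUV; apply/setP => i; have := eqUV (enum_val i).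
by rewrite !inE enum_valP !andbT.
Qed.

Definition separates n (T : topology n) (U : {set 'I_n}) :=
  U \in T /\ ~: U \in T.

(** The set [V] stands for the right factor of a join: an open set that meets the left factor
    contains the whole right one. The empty and full sets qualify and give the trivial
    decompositions. *)
Definition splits n (T : topology n) (V : {set 'I_n}) :=
  V \in T /\ forall O : {set 'I_n}, O \in T -> O \subset V \/ V \subset O.

(** Open sets on the two sides of a clopen set can be glued freely. Allowing arbitrary [S1] and [S2]
    on either side, rather than [U] and its complement, is what later lets the pieces of one
    decomposition be cut by another. *)
Lemma fsub_dot n (T : topology n) (U S1 S2 : {set 'I_n}) :
    separates T U -> S1 \subset U -> S2 \subset ~: U ->
  fsub T (S1 :|: S2) = fdot (fsub T S1) (fsub T S2).
Proof.
move=> [UT cUT] S1U S2U; rewrite fdotE -imset_sum_enum; apply: fsubE.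
have dis12 : [disjoint S1 & S2].
  by rewrite disjoints_subset (subset_trans S1U) // -setCS setCK.
split; first exact: sum_enum_inj.
apply: topology_eq => A; rewrite [LHS]mem_dot_opens.
apply/andP/imsetP => [[/imsetP[O1 O1T eq1] /imsetP[O2 O2T eq2]]|[O OT ->]].
  (* This open set agrees with [O1] on [S1] and with [O2] on [S2]. *)
  exists ((O1 :&: U) :|: (O2 :&: ~: U)).
    by apply: topU; apply: topI.
  apply: sum_setP; rewrite ?preim_sum_enuml ?preim_sum_enumr ?eq1 ?eq2.
    apply: eq_preim_enum_val; apply/setP => x; rewrite !inE.
    have [/(subsetP S1U)->|] := boolP (x \in S1); last by rewrite !andbF.
    by rewrite !andbT andbF orbF.
  apply: eq_preim_enum_val; apply/setP => x; rewrite !inE.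
  have [/(subsetP S2U)|] := boolP (x \in S2); last by rewrite !andbF.
  by rewrite !inE => /[dup] /negbTE-> ->; rewrite !andbT andbF.
by rewrite preim_sum_enuml preim_sum_enumr !imset_f.
Qed.

Lemma fsub_join n (T : topology n) (V S1 S2 : {set 'I_n}) :
    splits T V -> S1 \subset ~: V -> S2 \subset V ->
  fsub T (S1 :|: S2) = fjoin (fsub T S1) (fsub T S2).
Proof.
move=> [VT Vcmp] S1V S2V; rewrite fjoinE -imset_sum_enum; apply: fsubE.
have dis12 : [disjoint S1 & S2].
  by rewrite disjoints_subset (subset_trans S1V) // setCS.
split; first exact: sum_enum_inj.
have S1F x : x \in S1 -> x \in V = false.
  by move=> /(subsetP S1V); rewrite inE => /negbTE.
apply: topology_eq => A; rewrite [LHS]mem_join_opens.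
apply/idP/imsetP => [|[O OT ->]]; last first.
  rewrite preim_sum_enuml preim_sum_enumr !imset_f // andbT andTb.
  have [OV|VO] := Vcmp O OT; apply/orP; [right | left]; apply/eqP/setP => i.
    rewrite !inE; apply: contraFF (S1F _ (enum_valP i)); exact: (subsetP OV).
  by rewrite !inE (subsetP VO) // (subsetP S2V) // enum_valP.
case/orP=> /andP[].
  (* Adding [V] fills the right factor and leaves the trace on [S1] unchanged; below, intersecting
     with [V] empties the left factor and keeps the trace on [S2]. *)
  move=> /imsetP[O OT eq1] /eqP eq2; exists (O :|: V); first exact: topU.
  apply: sum_setP; rewrite ?preim_sum_enuml ?preim_sum_enumr ?eq1 ?eq2.
    apply: eq_preim_enum_val; apply/setP => x; rewrite !inE.
    by have [/S1F->|] := boolP (x \in S1); rewrite ?andbF // orbF.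
  apply/setP => i; rewrite !inE (subsetP S2V) ?orbT //; exact: enum_valP.
move=> /eqP eq1 /imsetP[O OT eq2]; exists (O :&: V); first exact: topI.
apply: sum_setP; rewrite ?preim_sum_enuml ?preim_sum_enumr ?eq1 ?eq2.
  by apply/setP => i; rewrite !inE (S1F _ (enum_valP i)) andbF.
apply: eq_preim_enum_val; apply/setP => x; rewrite !inE.
by have [/(subsetP S2V)->|] := boolP (x \in S2); rewrite ?andbF // !andbT.
Qed.

(** * Decompositions of a space as subsets of its points *)

Lemma embedding_lshift_dot m n (T : topology m) (S : topology n) :
  embedding T (top_dot T S) (@lshift m n).
Proof.
split; first exact: lshift_inj.
apply: topology_eq => U; apply/idP/imsetP => [UT|[W]]; last first.
  by rewrite [W \in _]mem_dot_opens => /andP[? _] ->.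
exists (@lshift m n @: U :|: @rshift m n @: set0); last by rewrite lpreU.
by rewrite [_ \in _]mem_dot_opens lpreU rpreU UT top0.
Qed.

Lemma embedding_rshift_dot m n (T : topology m) (S : topology n) :
  embedding S (top_dot T S) (@rshift m n).
Proof.
split; first exact: rshift_inj.
apply: topology_eq => U; apply/idP/imsetP => [UT|[W]]; last first.
  by rewrite [W \in _]mem_dot_opens => /andP[_ ?] ->.
exists (@lshift m n @: set0 :|: @rshift m n @: U); last by rewrite rpreU.
by rewrite [_ \in _]mem_dot_opens lpreU rpreU UT top0.
Qed.

Lemma embedding_lshift_join m n (T : topology m) (S : topology n) :
  embedding T (top_join T S) (@lshift m n).
Proof.
split; first exact: lshift_inj.
apply: topology_eq => U; apply/idP/imsetP => [UT|[W]]; last first.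
  rewrite [W \in _]mem_join_opens => /orP[/andP[? _]|/andP[/eqP lW _]] -> //.
  by rewrite lW top0.
exists (@lshift m n @: U :|: @rshift m n @: setT); last by rewrite lpreU.
by rewrite [_ \in _]mem_join_opens lpreU rpreU UT eqxx.
Qed.

Lemma embedding_rshift_join m n (T : topology m) (S : topology n) :
  embedding S (top_join T S) (@rshift m n).
Proof.
split; first exact: rshift_inj.
apply: topology_eq => U; apply/idP/imsetP => [UT|[W]]; last first.
  rewrite [W \in _]mem_join_opens => /orP[/andP[_ /eqP rW]|/andP[_ ?]] -> //.
  by rewrite rW topT.
exists (@lshift m n @: set0 :|: @rshift m n @: U); last by rewrite rpreU.
by rewrite [_ \in _]mem_join_opens lpreU rpreU UT eqxx orbT.
Qed.

Lemma imset_rshiftC m n : @rshift m n @: setT = ~: (@lshift m n @: setT).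
Proof.
apply/setP => i; rewrite inE -(splitK i); case: (split i) => j /=.
  rewrite [X in ~~ X]imset_f //; apply/negP => /imsetP[k _ /eqP].
  by rewrite eq_lrshift.
rewrite [LHS]imset_f //; apply/esym/negP => /imsetP[k _ /eqP].
by rewrite eq_rlshift.
Qed.

(** A homeomorphism onto the sum carries the left summand to a clopen set; conversely [fsub_dot]
    rebuilds the space from a clopen set and its complement. *)
Lemma fdotP n (T : topology n) X Y : fclass T = fdot X Y <->
  exists U, [/\ separates T U, X = fsub T U & Y = fsub T (~: U)].
Proof.
split=> [|[U [sepU -> ->]]]; last first.
  by rewrite -(fsub_dot sepU) // setUCr fsubT.
elim/fspaceW: X => m A; elim/fspaceW: Y => p B.
rewrite fdotE => /fclassP/homeoE[/= f [g [fK gK fT]]].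
have g_emb := embedding_homeo (S := top_dot A B) fK gK fT.
have imC (C : {set 'I_(m + p)}) : g @: C = f @^-1: C.
  exact: can2_imset_pre.
have lE : @lshift m p @: setT = @lshift m p @: setT :|: @rshift m p @: set0.
  by rewrite imset0 setU0.
have rE : @rshift m p @: setT = @lshift m p @: set0 :|: @rshift m p @: setT.
  by rewrite imset0 set0U.
have cE : ~: (g @: (@lshift m p @: setT)) = g @: (@rshift m p @: setT).
  by rewrite imset_rshiftC !imC preimsetC.
exists (g @: (@lshift m p @: setT)); rewrite /separates cE.
split; last 2 first.
- by rewrite -imset_comp
    (fsubE (embedding_comp (embedding_lshift_dot _ _) g_emb)).
- by rewrite -imset_comp
    (fsubE (embedding_comp (embedding_rshift_dot _ _) g_emb)).
split; last first.
  by rewrite rE imC fT [_ \in _]mem_dot_opens lpreU rpreU top0 topT.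
by rewrite lE imC fT [_ \in _]mem_dot_opens lpreU rpreU top0 topT.
Qed.

(** Here [V] is the copy of the right factor, the open one, so the left factor is the complement. *)
Lemma fjoinP n (T : topology n) X Y : fclass T = fjoin X Y <->
  exists V, [/\ splits T V, X = fsub T (~: V) & Y = fsub T V].
Proof.
split=> [|[V [splV -> ->]]]; last first.
  by rewrite -(fsub_join splV) // setUC setUCr fsubT.
elim/fspaceW: X => m A; elim/fspaceW: Y => p B.
rewrite fjoinE => /fclassP/homeoE[/= f [g [fK gK fT]]].
have g_emb := embedding_homeo (S := top_join A B) fK gK fT.
have imC (C : {set 'I_(m + p)}) : g @: C = f @^-1: C.
  exact: can2_imset_pre.
have rE : @rshift m p @: setT = @lshift m p @: set0 :|: @rshift m p @: setT.
  by rewrite imset0 set0U.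
exists (g @: (@rshift m p @: setT)).
have -> : ~: (g @: (@rshift m p @: setT)) = g @: (@lshift m p @: setT).
  by rewrite imset_rshiftC !imC preimsetC setCK.
split; last 2 first.
- by rewrite -imset_comp
    (fsubE (embedding_comp (embedding_lshift_join _ _) g_emb)).
- by rewrite -imset_comp
    (fsubE (embedding_comp (embedding_rshift_join _ _) g_emb)).
split.
  by rewrite rE imC fT [_ \in _]mem_join_opens lpreU rpreU topT !eqxx orbT.
move=> O OT; have : g @^-1: O \in top_join A B.
  rewrite -[_ \in _]fT; suff -> : f @^-1: (g @^-1: O) = O by [].
  by apply/setP => x; rewrite !inE fK.
rewrite [_ \in _]mem_join_opens.
(* An open set of the join either fills the right factor, and then contains [V], or misses the left
   one, and then lies in [V]. *)
case/orP=> /andP[]; [move=> _ /eqP/setP rO | move=> /eqP/setP lO _].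
  right; apply/subsetP => _ /imsetP[_ /imsetP[i _ ->] ->].
  by have := rO i; rewrite !inE.
left; apply/subsetP => x xO; rewrite imset_rshiftC imC !inE.
apply/negP => /imsetP[i _ fx]; have := lO i.
by rewrite !inE -fx fK xO.
Qed.

Lemma fspace_topology (X : fspace) : exists n (T : topology n), X = fclass T.
Proof. by exists (tag (repr X)), (tagged (repr X)); rewrite fclass_repr. Qed.

(** * Comparing two decompositions of one space *)

Lemma fdot_refinement A B C D : fdot A B = fdot C D ->
  exists x y z w,
    [/\ A = fdot x y, B = fdot z w, C = fdot x z & D = fdot y w].
Proof.
have [n [T defT]] := fspace_topology (fdot A B); rewrite defT => eqCD.
have /fdotP[U [sepU -> ->]] := esym defT.
have /fdotP[V [sepV -> ->]] := eqCD.
exists (fsub T (U :&: V)), (fsub T (U :&: ~: V)).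
exists (fsub T (~: U :&: V)), (fsub T (~: U :&: ~: V)); split.
- by rewrite -(fsub_dot sepV) ?subsetIr // -setIUr setUCr setIT.
- by rewrite -(fsub_dot sepV) ?subsetIr // -setIUr setUCr setIT.
- by rewrite -(fsub_dot sepU) ?subsetIl // -setIUl setUCr setTI.
- by rewrite -(fsub_dot sepU) ?subsetIl // -setIUl setUCr setTI.
Qed.

(** The middle layer is [W :\: V]: the space is the join of [~: W], [W :\: V] and [V], in this
    order. *)
Lemma fsub_join_between n (T : topology n) (V W : {set 'I_n}) :
    splits T V -> splits T W -> V \subset W ->
  exists Z, fsub T (~: V) = fjoin (fsub T (~: W)) Z /\
            fsub T W = fjoin Z (fsub T V).
Proof.
move=> splV splW sVW; exists (fsub T (W :\: V)); split.
  rewrite -(fsub_join splW) ?subsetDl // setDE setUIr [~: W :|: W]setUC setUCr.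
  by rewrite setTI (setUidPr _) // setCS.
rewrite -(fsub_join splV) ?subsetDr // setDE setUIl [~: V :|: V]setUC setUCr.
by rewrite setIT (setUidPl _).
Qed.

Lemma fjoin_levi A B C D : fjoin A B = fjoin C D ->
  exists Z, (C = fjoin A Z /\ B = fjoin Z D) \/
            (A = fjoin C Z /\ D = fjoin Z B).
Proof.
have [n [T defT]] := fspace_topology (fjoin A B); rewrite defT => eqCD.
have /fjoinP[V [splV -> ->]] := esym defT.
have /fjoinP[W [splW -> ->]] := eqCD.
have [sWV|sVW] := splV.2 W splW.1.
  by have [Z ZP] := fsub_join_between splW splV sWV; exists Z; left.
by have [Z ZP] := fsub_join_between splV splW sVW; exists Z; right.
Qed.

(** A set [V] comparable with a clopen [U] and with its complement either contains both, hence is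
    full; or lies in both, hence is empty; or lies between them, which forces [U] or its complement
    to be empty. Each case makes one factor trivial. *)
Lemma fdot_neq_fjoin A B C D :
    A != fone -> B != fone -> C != fone -> D != fone ->
  fdot A B <> fjoin C D.
Proof.
move=> A1 B1 C1 D1; have [n [T defT]] := fspace_topology (fdot A B).
rewrite defT => eqCD.
have /fdotP[U [[UT cUT] eqA eqB]] := esym defT.
have /fjoinP[V [[VT Vcmp] eqC eqD]] := eqCD.
have U0 : U != set0 by apply: contraNneq A1 => /fsub_eq1/eqP; rewrite eqA.
have cU0 : ~: U != set0 by apply: contraNneq B1 => /fsub_eq1/eqP; rewrite eqB.
have cV0 : ~: V != set0 by apply: contraNneq C1 => /fsub_eq1/eqP; rewrite eqC.
have V0 : V != set0 by apply: contraNneq D1 => /fsub_eq1/eqP; rewrite eqD.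
have [UV|VU] := Vcmp _ UT; have [cUV|VcU] := Vcmp _ cUT.
- case/negP: cV0; rewrite -subset0 -setCT setCS -(setUCr U) subUset.
  by rewrite UV cUV.
- case/negP: U0; rewrite -subset0 -(setICr U) subsetI subxx.
  exact: subset_trans UV VcU.
- case/negP: cU0; rewrite -subset0 -(setICr U) subsetI subxx andbT.
  exact: subset_trans cUV VU.
- by case/negP: V0; rewrite -subset0 -(setICr U) subsetI VU.
Qed.

(** * The number of points as a degree, and values of decompositions in smaller degree *)

Definition fsize (X : fspace) := tag (repr X).

Lemma fsize_fclass n (T : topology n) : fsize (fclass T) = n.
Proof.
have [f [g [fK gK _]]] := homeo_fclass T.
by rewrite /fsize -[LHS]card_ord -[RHS]card_ord;
  apply: (bij_eq_card (f := f)); exists g.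
Qed.

Lemma fsize_eq0 X : (fsize X == 0) = (X == fone).
Proof.
elim/fspaceW: X => n T; rewrite fsize_fclass.
by apply/eqP/eqP => /fclass_eq1.
Qed.

Lemma fsize_dot X Y : fsize (fdot X Y) = fsize X + fsize Y.
Proof.
elim/fspaceW: X => m T; elim/fspaceW: Y => n S.
by rewrite fdotE !fsize_fclass.
Qed.

Lemma fsize_join X Y : fsize (fjoin X Y) = fsize X + fsize Y.
Proof.
elim/fspaceW: X => m T; elim/fspaceW: Y => n S.
by rewrite fjoinE !fsize_fclass.
Qed.

Section SmallerDegrees.
Variables (B : Type) (mul : B -> B -> B) (phi : fspace -> B).
Variables a b c d : fspace.
Hypotheses (a1 : a != fone) (b1 : b != fone) (c1 : c != fone) (d1 : d != fone).
Hypothesis mulA : associative mul.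

(** The four corners turn the claim into [(xy)(zw) = (xz)(yw)]. Multiplicativity may be used on [a],
    [b], [c] and [d] because each is strictly smaller than the whole, its partner being
    nontrivial. *)
Lemma fdot_image : commutative mul -> fdot a b = fdot c d ->
    (forall x y, fsize x + fsize y < fsize a + fsize b ->
      phi (fdot x y) = mul (phi x) (phi y)) ->
  mul (phi a) (phi b) = mul (phi c) (phi d).
Proof.
move=> mulC eq_ab_cd phiM.
have eq_size : fsize a + fsize b = fsize c + fsize d.
  by rewrite -!fsize_dot eq_ab_cd.
have [x [y [z [w [def_a def_b def_c def_d]]]]] := fdot_refinement eq_ab_cd.
have -> : phi a = mul (phi x) (phi y).
  by rewrite def_a phiM // -fsize_dot -def_a -addn1 leq_add2l lt0n fsize_eq0.
have -> : phi b = mul (phi z) (phi w).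
  by rewrite def_b phiM // -fsize_dot -def_b -add1n leq_add2r lt0n fsize_eq0.
have -> : phi c = mul (phi x) (phi z).
  rewrite def_c phiM // -fsize_dot -def_c eq_size.
  by rewrite -addn1 leq_add2l lt0n fsize_eq0.
have -> : phi d = mul (phi y) (phi w).
  rewrite def_d phiM // -fsize_dot -def_d eq_size.
  by rewrite -add1n leq_add2r lt0n fsize_eq0.
rewrite -!mulA; congr mul; rewrite !mulA; congr mul; exact: mulC.
Qed.

(** Levi's lemma turns the claim into one instance of associativity on three layers; nontrivial
    partners again keep all factors in smaller degree. *)
Lemma fjoin_image : fjoin a b = fjoin c d ->
    (forall x y, fsize x + fsize y < fsize a + fsize b ->
      phi (fjoin x y) = mul (phi x) (phi y)) ->
  mul (phi a) (phi b) = mul (phi c) (phi d).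
Proof.
move=> eq_ab_cd phiM.
have eq_size : fsize a + fsize b = fsize c + fsize d.
  by rewrite -!fsize_join eq_ab_cd.
have phi_a x y : a = fjoin x y -> phi a = mul (phi x) (phi y).
  move=> def; rewrite def phiM // -fsize_join -def.
  by rewrite -addn1 leq_add2l lt0n fsize_eq0.
have phi_b x y : b = fjoin x y -> phi b = mul (phi x) (phi y).
  move=> def; rewrite def phiM // -fsize_join -def.
  by rewrite -add1n leq_add2r lt0n fsize_eq0.
have phi_c x y : c = fjoin x y -> phi c = mul (phi x) (phi y).
  move=> def; rewrite def phiM // -fsize_join -def eq_size.
  by rewrite -addn1 leq_add2l lt0n fsize_eq0.
have phi_d x y : d = fjoin x y -> phi d = mul (phi x) (phi y).
  move=> def; rewrite def phiM // -fsize_join -def eq_size.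
  by rewrite -add1n leq_add2r lt0n fsize_eq0.
have [z [[/phi_c-> /phi_b->]|[/phi_a-> /phi_d->]]] := fjoin_levi eq_ab_cd.
  exact: mulA.
exact/esym/mulA.
Qed.

End SmallerDegrees.

(** * Extending maps from indecomposables, for several operations with one unit *)

Section GradedOperations.
Variables (M : eqType) (I : Type) (one : M) (op : I -> M -> M -> M).
Variable deg : M -> nat.
Hypothesis deg_eq0 : forall x, (deg x == 0) = (x == one).
Hypothesis degM : forall i x y, deg (op i x y) = deg x + deg y.
Hypothesis op1x : forall i x, op i one x = x.
Hypothesis opx1 : forall i x, op i x one = x.

(** All operations are excluded at once: with one operation this is connectedness or
    join-indecomposability, with both it is irreducibility. *)
Definition indecomposable x :=
  x != one /\ ~ exists i y z, [/\ y != one, z != one & x = op i y z].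

Variables (B : Type) (oneB : B) (mulB : I -> B -> B -> B).
Hypothesis mulB1x : forall i x, mulB i oneB x = x.
Hypothesis mulBx1 : forall i x, mulB i x oneB = x.

Definition operation_morphism (phi : M -> B) :=
  phi one = oneB /\ forall i x y, phi (op i x y) = mulB i (phi x) (phi y).

Lemma operation_morphism_ext (phi psi : M -> B) :
    operation_morphism phi -> operation_morphism psi ->
    (forall x, indecomposable x -> phi x = psi x) ->
  phi =1 psi.
Proof.
move=> [phi1 phiM] [psi1 psiM] eq_ind x.
have [n] := ubnP (deg x); elim: n x => // n IHn x; rewrite ltnS => le_xn.
have [->|x1] := eqVneq x one; first by rewrite phi1 psi1.
have [[i [y [z [y1 z1 def_x]]]]|no_dec] := excluded_middle_informative
  (exists i y z, [/\ y != one, z != one & x = op i y z]); last exact: eq_ind.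
move: le_xn; rewrite -!deg_eq0 -!lt0n in y1 z1; rewrite def_x degM => le_xn.
rewrite phiM psiM !IHn //; apply: leq_trans le_xn.
  by rewrite -addn1 addnC leq_add2r.
by rewrite -addn1 leq_add2l.
Qed.

(* Stated on images under phi so that one hypothesis covers refinement (sum), *)
(* Levi's lemma (join) and the impossible case i <> j.                        *)
Hypothesis refinement : forall (phi : M -> B) (i j : I) (a b c d : M),
    a != one -> b != one -> c != one -> d != one -> op i a b = op j c d ->
    (forall k x y, deg x + deg y < deg a + deg b ->
      phi (op k x y) = mulB k (phi x) (phi y)) ->
  mulB i (phi a) (phi b) = mulB j (phi c) (phi d).

(** A decomposition of each decomposable element is fixed by choice and the map is defined through
    it by recursion on the degree. Multiplicativity then says that the chosen decomposition does not
    matter, which is [refinement] within an induction on the degree. *)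
Lemma operation_morphism_exists (f : M -> B) : exists2 phi,
  operation_morphism phi & forall x, indecomposable x -> phi x = f x.
Proof.
pose decomposes x (d : option (I * M * M)) :=
  if d is Some (i, y, z) then [/\ y != one, z != one & x = op i y z]
  else ~ exists i y z, [/\ y != one, z != one & x = op i y z].
have dec_ex x : exists d, decomposes x d.
  have [[i [y [z yzP]]]|] := excluded_middle_informative
    (exists i y z, [/\ y != one, z != one & x = op i y z]).
    by exists (Some (i, y, z)).
  by exists None.
pose dec x := proj1_sig (constructive_indefinite_description _ (dec_ex x)).
have decP x : decomposes x (dec x)
  by rewrite /dec; case: (constructive_indefinite_description _ _).
(* The argument [n] is fuel. The degree of [x] suffices, since both chosen factors have smaller
   degree; with no fuel left, an element of degree 0 is the unit and gets [oneB]. *)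
pose ext := fix ext n x := if n is n'.+1 then
  match dec x with
  | Some (i, y, z) => mulB i (ext n' y) (ext n' z)
  | None => if x == one then oneB else f x
  end else if x == one then oneB else f x.
have deg_dec x i y z :
    dec x = Some (i, y, z) -> deg y < deg x /\ deg z < deg x.
  move=> dx; have := decP x; rewrite dx => -[].
  rewrite -!deg_eq0 -!lt0n => y0 z0 ->; rewrite degM.
  rewrite -[X in X < _ /\ _]addn0 -[X in _ /\ X < _]add0n.
  by rewrite ltn_add2l ltn_add2r.
have ext_stable m n x : deg x <= m -> deg x <= n -> ext m x = ext n x.
  elim: m n x => [|m IHm] [|n] x //=.
  - case dx: (dec x) => [[[i y] z]|] // dx0 _.
    by have [] := deg_dec _ _ _ _ dx; move: dx0; rewrite leqn0 => /eqP->.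
  - case dx: (dec x) => [[[i y] z]|] // _ dx0.
    by have [] := deg_dec _ _ _ _ dx; move: dx0; rewrite leqn0 => /eqP->.
  case dx: (dec x) => [[[i y] z]|] // xm xn.
  have [yx zx] := deg_dec _ _ _ _ dx.
  have le y' k : deg y' < deg x -> deg x <= k.+1 -> deg y' <= k.
    by move=> lt_x le_x; apply: leq_trans lt_x le_x.
  by rewrite (IHm n y) ?(IHm n z) //; apply: le.
pose phi x := ext (deg x) x.
have phi_one : phi one = oneB.
  by rewrite /phi; have /eqP-> : deg one == 0; rewrite /= ?deg_eq0 eqxx.
have phi_dec x : x != one -> phi x =
    if dec x is Some (i, y, z) then mulB i (phi y) (phi z) else f x.
  move=> x1; rewrite /phi; have := x1; rewrite -deg_eq0.
  case Dx: (deg x) => [//|n] _ /=.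
  case dx: (dec x) => [[[i y] z]|]; last by rewrite (negbTE x1).
  have [yx zx] := deg_dec _ _ _ _ dx; rewrite Dx !ltnS in yx zx.
  by rewrite (ext_stable n (deg y)) // (ext_stable n (deg z)).
exists phi; last first.
  move=> x [x1 no_dec]; rewrite phi_dec //; have := decP x.
  case: (dec x) => [[[i y] z] /= yzP|//].
  by case: no_dec; exists i, y, z.
split=> // i x y; have [n] := ubnP (deg x + deg y).
elim: n i x y => // n IHn i x y; rewrite ltnS => le_n.
have [->|x1] := eqVneq x one; first by rewrite op1x phi_one mulB1x.
have [->|y1] := eqVneq y one; first by rewrite opx1 phi_one mulBx1.
rewrite phi_dec; last first.
  by rewrite -deg_eq0 degM addn_eq0 deg_eq0 (negbTE x1).
(* The decomposition chosen for [op i x y] may involve another operation [j] and other factors;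
   [refinement] equates the two values, using the induction hypothesis in smaller degree. *)
have := decP (op i x y); case: (dec _) => [[[j c] d] /= [c1 d1 eq_cd]|[]].
  apply/esym/refinement => // k u v lt_uv; apply: IHn.
  exact: leq_trans lt_uv le_n.
by exists i, x, y.
Qed.

End GradedOperations.

(** * Linear extension to the algebras of finite spaces *)

Local Open Scope ring_scope.

(** Linearity is a hypothesis on bare functions, so that the lemma also applies to maps such as a
    product with one argument fixed. *)
Lemma malg_linear_ext (K : fieldType) (M : choiceType) (V : lmodType K)
    (phi psi : {malg K[M]} -> V) :
    linear phi -> linear psi -> (forall X, phi << X >> = psi << X >>) ->
  phi =1 psi.
Proof.
move=> phi_lin psi_lin eqU x.
pose Phi : {linear {malg K[M]} -> V} :=
  HB.pack phi (GRing.isLinear.Build _ _ _ _ _ phi_lin).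
pose Psi : {linear {malg K[M]} -> V} :=
  HB.pack psi (GRing.isLinear.Build _ _ _ _ _ psi_lin).
rewrite -[phi x]/(Phi x) -[psi x]/(Psi x) (monalgE x) !linear_sum.
apply: eq_bigr => k _.
have -> : << x@_k *g k >> = x@_k *: << k >> :> {malg K[M]}.
  by apply/malgP => j; rewrite mcoeffZ !mcoeffU mulrnAr mulr1.
by rewrite !linearZ /= eqU.
Qed.

(** This is the universal property of a monoid algebra; [B] may be noncommutative, as the join
    product requires. *)
Lemma malg_morphism_exists (K : fieldType) (M : monomType) (B : algType K)
    (h : M -> B) :
    h mone = 1 -> {morph h : x y / mmul x y >-> x * y} ->
  exists phi : {lrmorphism {malg K[M]} -> B}, forall X, phi << X >> = h X.
Proof.
move=> h1 hM.
pose h_mixin := isMultiplicative.Build M B h (hM, h1).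
pose H : {mmorphism M -> B} := HB.pack h h_mixin.
(* Multiplicativity only needs the coefficients to commute with the image of [H], and scalars are
   central in [B]. *)
have mult : multiplicative (mmap (GRing.in_alg B) H).
  apply: commr_mmap_is_multiplicative => g m m'.
  by rewrite /GRing.comm mulr_algl mulr_algr.
have scal : scalable (mmap (GRing.in_alg B) H).
  by move=> c g; rewrite mmapZ /= mulr_algl.
pose phi : {lrmorphism {malg K[M]} -> B} :=
  HB.pack (mmap (GRing.in_alg B) H) (GRing.isMultiplicative.Build _ _ _ mult)
    (GRing.isScalable.Build _ _ _ _ _ scal).
by exists phi => X; rewrite /= mmapU /= scale1r mul1r.
Qed.

Lemma FS_dot_freely_generated (K : fieldType) :
  com_alg_freely_generated (A := FS_dot K) (@basis_vectors K connected).
Proof.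
move=> B f; pose op (i : unit) := fdot; pose mulB (i : unit) := @GRing.mul B.
have indE X : connected X <-> indecomposable fone op X.
  split=> -[X1 no_dec]; split=> //.
    by move=> [i [Y [Z YZ]]]; apply: no_dec; exists Y, Z.
  by move=> [Y [Z YZ]]; apply: no_dec; exists tt, Y, Z.
have [h [h1 hM] hf] : exists2 h : fspace -> B,
    operation_morphism fone op 1 mulB h &
    forall X, indecomposable fone op X -> h X = f << X >>.
  apply: (operation_morphism_exists fsize_eq0 (fun _ => fsize_dot)
    (fun _ => fdot1x) (fun _ => fdotx1)
    (fun _ => @mul1r B) (fun _ => @mulr1 B)).
  move=> phi [] [] a b c d a1 b1 c1 d1 eq_ab phiM.
  by apply: (fdot_image a1 b1 c1 d1 (@mulrA B) (@mulrC B) eq_ab) => x y;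
    exact: (phiM tt).
have [phi phiU] := @malg_morphism_exists K fspace_dot B h h1 (hM tt).
exists phi; split=> [x [X /indE Xc ->]|psi psiP].
  by rewrite [LHS]phiU hf.
apply: (@malg_linear_ext K fspace_dot B psi phi
  (linearP psi) (linearP phi)) => X.
rewrite [RHS]phiU; move: X; apply: (operation_morphism_ext (op := op)
  (mulB := mulB) (oneB := 1) fsize_eq0 (fun _ => fsize_dot)) => //.
- split=> [|i X Y]; first exact: (rmorph1 psi).
  by rewrite -[RHS](rmorphM psi) FS_dotU.
by move=> X Xc; rewrite hf // psiP //; exists X => //; apply/indE.
Qed.

Lemma FS_joinM (K : fieldType) (X Y : fspace) :
  (<< X >> : FS_join K) * << Y >> = << fjoin X Y >> :> FS_join K.
Proof. by rewrite [LHS]fgmulUU mulr1. Qed.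

Lemma FS_join_freely_generated (K : fieldType) :
  alg_freely_generated (A := FS_join K)
    (@basis_vectors K join_indecomposable).
Proof.
move=> B f; pose op (i : unit) := fjoin; pose mulB (i : unit) := @GRing.mul B.
have indE X : join_indecomposable X <-> indecomposable fone op X.
  split=> -[X1 no_dec]; split=> //.
    by move=> [i [Y [Z YZ]]]; apply: no_dec; exists Y, Z.
  by move=> [Y [Z YZ]]; apply: no_dec; exists tt, Y, Z.
have [h [h1 hM] hf] : exists2 h : fspace -> B,
    operation_morphism fone op 1 mulB h &
    forall X, indecomposable fone op X -> h X = f << X >>.
  apply: (operation_morphism_exists fsize_eq0 (fun _ => fsize_join)
    (fun _ => fjoin1x) (fun _ => fjoinx1)
    (fun _ => @mul1r B) (fun _ => @mulr1 B)).
  move=> phi [] [] a b c d a1 b1 c1 d1 eq_ab phiM.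
  by apply: (fjoin_image a1 b1 c1 d1 (@mulrA B) eq_ab) => x y;
    exact: (phiM tt).
have [phi phiU] := @malg_morphism_exists K fspace_join B h h1 (hM tt).
exists phi; split=> [x [X /indE Xc ->]|psi psiP].
  by rewrite [LHS]phiU hf.
apply: (@malg_linear_ext K fspace_join B psi phi
  (linearP psi) (linearP phi)) => X.
rewrite [RHS]phiU; move: X; apply: (operation_morphism_ext (op := op)
  (mulB := mulB) (oneB := 1) fsize_eq0 (fun _ => fsize_join)) => //.
- split=> [|i X Y]; first exact: (rmorph1 psi).
  by rewrite -[RHS](rmorphM psi) FS_joinM.
by move=> X Xc; rewrite hf // psiP //; exists X => //; apply/indE.
Qed.

(** Both sides are bilinear, so they are compared on basis vectors one argument at a time. *)
Lemma join_mul_morph (K : fieldType) (B : comAsType K)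
    (phi : {linear FS_dot K -> B}) :
    (forall X Y, phi << fjoin X Y >> = join_mul (phi << X >>) (phi << Y >>)) ->
  {morph phi : x y / join_mul x y}.
Proof.
move=> phiM x y; move: x.
apply: (@malg_linear_ext K fspace_dot B (fun x : FS_dot K => phi (join_mul x y))
  (fun x : FS_dot K => join_mul (phi x) (phi y))) => [c u v|c u v|X].
- by rewrite join_mul_linearl linearP.
- by rewrite linearP join_mul_linearl.
move: y; apply: (@malg_linear_ext K fspace_dot B
  (fun y : FS_dot K => phi (join_mul (<< X >> : FS_dot K) y))
  (fun y : FS_dot K => join_mul (phi << X >>) (phi y))) => [c u v|c u v|Y].
- by rewrite join_mul_linearr linearP.
- by rewrite linearP join_mul_linearr.
by rewrite -phiM; congr (phi _); exact: FS_joinU.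
Qed.

(** The operations are indexed by booleans, [true] for the sum and [false] for the join. The algebra
    morphism is built from the sum alone, and its compatibility with the join is then checked on
    basis vectors. *)
Lemma FS_com_as_freely_generated (K : fieldType) :
  com_as_freely_generated (A := FS_dot K) (@basis_vectors K irreducible).
Proof.
move=> B f; pose op (i : bool) := if i then fdot else fjoin.
pose mulB (i : bool) := if i then @GRing.mul B else @join_mul K B.
have indE X : irreducible X <-> indecomposable fone op X.
  split=> [[[X1 no_dot] [_ no_join]]|[X1 no_dec]].
    split=> // -[[] [Y [Z YZ]]]; first by apply: no_dot; exists Y, Z.
    by apply: no_join; exists Y, Z.
  split; split=> // -[Y [Z YZ]]; apply: no_dec; first by exists true, Y, Z.
  by exists false, Y, Z.
have size_op i X Y : fsize (op i X Y) = (fsize X + fsize Y)%N.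
  by case: i; rewrite ?fsize_dot ?fsize_join.
have [h [h1 hM] hf] : exists2 h : fspace -> B,
    operation_morphism fone op 1 mulB h &
    forall X, indecomposable fone op X -> h X = f << X >>.
  apply: (operation_morphism_exists fsize_eq0 size_op).
  - by case=> X; rewrite /op ?fdot1x ?fjoin1x.
  - by case=> X; rewrite /op ?fdotx1 ?fjoinx1.
  - by case=> b; rewrite /mulB ?mul1r ?join_mul1x.
  - by case=> b; rewrite /mulB ?mulr1 ?join_mulx1.
  move=> phi [] [] a b c d a1 b1 c1 d1 eq_ab phiM.
  - by apply: (fdot_image a1 b1 c1 d1 (@mulrA B) (@mulrC B) eq_ab) => x y;
    exact: (phiM true).
  (* The two mixed cases are vacuous: no space is both a nontrivial sum and a nontrivial join. *)
  - by case: (fdot_neq_fjoin a1 b1 c1 d1 eq_ab).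
  - by case: (fdot_neq_fjoin c1 d1 a1 b1 (esym eq_ab)).
  by apply: (fjoin_image a1 b1 c1 d1 (@join_mulA K B) eq_ab) => x y;
    exact: (phiM false).
have [phi phiU] := @malg_morphism_exists K fspace_dot B h h1 (hM true).
exists phi; split=> [|x [X /indE Xc ->]|psi psi_join psiP].
- apply: join_mul_morph => X Y.
  rewrite [LHS]phiU [LHS](hM false).
  by congr join_mul; exact: esym (phiU _).
- by rewrite [LHS]phiU hf.
apply: (@malg_linear_ext K fspace_dot B psi phi
  (linearP psi) (linearP phi)) => X.
rewrite [RHS]phiU; move: X; apply: (operation_morphism_ext (op := op)
  (mulB := mulB) (oneB := 1) fsize_eq0 size_op) => //.
- split=> [|[] X Y]; first exact: (rmorph1 psi).
    by rewrite -[RHS](rmorphM psi) FS_dotU.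
  by rewrite -[RHS]psi_join FS_joinU.
by move=> X Xc; rewrite hf // psiP //; exists X => //; apply/indE.
Qed.

Theorem theorem4 (K : fieldType) :
  [/\ com_alg_freely_generated (A := FS_dot K) (@basis_vectors K connected),
      alg_freely_generated (A := FS_join K)
        (@basis_vectors K join_indecomposable)
    & com_as_freely_generated (A := FS_dot K) (@basis_vectors K irreducible)].
Proof.
split; first exact: FS_dot_freely_generated.
  exact: FS_join_freely_generated.
exact: FS_com_as_freely_generated.
Qed.
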